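(* Let $\alpha,\beta\in\mathbb{R}$ with $\alpha\neq 0$, and let $(G_1,g,J)$ be the connected, simply connected three-dimensional Lorentzian Lie group with product structure $J$ whose Lie algebra $\mathfrak{g}$ has a pseudo-orthonormal basis $\{e_1,e_2,e_3\}$ ($e_3$ timelike) with $[e_1,e_2]=\alpha e_1-\beta e_3$, $[e_1,e_3]=-\alpha e_1-\beta e_2$, $[e_2,e_3]=\beta e_1+\alpha e_2+\alpha e_3$. Let $c\in\mathbb{R}$. Then $(G_1,g,J)$ is a first kind algebraic Ricci soliton associated to the Kobayashi-Nomizu connection $\nabla^1$ with constant $c$ if and only if $\beta=0$, $c=0$, $\alpha\neq 0$. In particular, in that case $\mathrm{Ric}^1(e_1)=De_1=-\alpha^2e_1$, $\mathrm{Ric}^1(e_2)=De_2=-\alpha^2e_2-\alpha^2e_3$, $\mathrm{Ric}^1(e_3)=De_3=0$.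
   Context: The left-invariant Lorentzian metric $g$ satisfies $g(e_1,e_1)=g(e_2,e_2)=1$, $g(e_3,e_3)=-1$, $g(e_i,e_j)=0$ for $i\ne j$. All tensors and connections are left-invariant and evaluated on $\mathfrak{g}$. $\nabla$ is the Levi-Civita connection of $g$. The product structure is $Je_1=e_1$, $Je_2=e_2$, $Je_3=-e_3$, and $(\nabla_XJ)Y=\nabla_X(JY)-J(\nabla_XY)$. The canonical connection is $\nabla^0_XY=\nabla_XY-\frac12(\nabla_XJ)(JY)$ and the Kobayashi-Nomizu connection is $\nabla^1_XY=\nabla^0_XY-\frac14[(\nabla_YJ)(JX)-(\nabla_{JY}J)X]$, with curvature $R^1(X,Y)Z=\nabla^1_X\nabla^1_YZ-\nabla^1_Y\nabla^1_XZ-\nabla^1_{[X,Y]}Z$. Its Ricci tensor is $\rho^1(X,Y)=-g(R^1(X,e_1)Y,e_1)-g(R^1(X,e_2)Y,e_2)+g(R^1(X,e_3)Y,e_3)$ and the Ricci operator $\mathrm{Ric}^1$ is defined by $\rho^1(X,Y)=g(\mathrm{Ric}^1(X),Y)$. First kind algebraic Ricci soliton associated to $\nabla^1$ with constant $c$ means: $\mathrm{Ric}^1=c\,\mathrm{Id}+D$ where $D$ is a derivation of $\mathfrak{g}$, i.e. a linear map with $D[X,Y]=[DX,Y]+[X,DY]$ for all $X,Y\in\mathfrak{g}$. *)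

(* Defs.v *)
From mathcomp Require Import all_boot all_order all_algebra sesquilinear reals.

Set Implicit Arguments.
Unset Strict Implicit.
Unset Printing Implicit Defensive.
Import GRing.Theory.
Local Open Scope ring_scope.

(* The Lie group is represented by its Lie algebra: V is the space of
   left-invariant vector fields, left-invariant connections are bilinear maps
   V -> V -> V, and left-invariant (1,1)-tensors are endomorphisms of V. *)

Definition lie_bracket (R : realType) (V : vectType R)
    (br : {bilinear V -> V -> V}) : Prop :=
  (forall X, br X X = 0) /\
  (forall X Y Z, br X (br Y Z) + br Y (br Z X) + br Z (br X Y) = 0).

Definition pseudo_orthonormal_basis (R : realType) (V : vectType R)
    (g : {biscalar V}) (e1 e2 e3 : V) : Prop :=
  [/\ basis_of fullv [:: e1; e2; e3],
      [/\ g e1 e1 = 1, g e2 e2 = 1 & g e3 e3 = -1],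
      [/\ g e1 e2 = 0, g e1 e3 = 0 & g e2 e3 = 0] &
      [/\ g e2 e1 = 0, g e3 e1 = 0 & g e3 e2 = 0]].

(* g X Y is a constant function on the group for left-invariant X and Y, so
   the term X (g Y Z) of metric compatibility vanishes. *)
Definition levi_civita (R : realType) (V : vectType R)
    (br : {bilinear V -> V -> V}) (g : {biscalar V})
    (nabla : {bilinear V -> V -> V}) : Prop :=
  (forall X Y, nabla X Y - nabla Y X = br X Y) /\
  (forall X Y Z, g (nabla X Y) Z + g Y (nabla X Z) = 0).

Definition product_structure (R : realType) (V : vectType R)
    (e1 e2 e3 : V) (J : 'End(V)) : Prop :=
  [/\ J e1 = e1, J e2 = e2 & J e3 = - e3].

(* (nabla_X J) Y *)
Definition nablaJ (R : realType) (V : vectType R)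
    (nabla : V -> V -> V) (J : 'End(V)) (X Y : V) : V :=
  nabla X (J Y) - J (nabla X Y).

Definition canonical_connection (R : realType) (V : vectType R)
    (nabla : V -> V -> V) (J : 'End(V)) (X Y : V) : V :=
  nabla X Y - (2%:R^-1 : R) *: nablaJ nabla J X (J Y).

Definition kobayashi_nomizu (R : realType) (V : vectType R)
    (nabla : V -> V -> V) (J : 'End(V)) (X Y : V) : V :=
  canonical_connection nabla J X Y
  - (4%:R^-1 : R) *: (nablaJ nabla J Y (J X) - nablaJ nabla J (J Y) X).

Definition curvature (R : realType) (V : vectType R)
    (br conn : V -> V -> V) (X Y Z : V) : V :=
  conn X (conn Y Z) - conn Y (conn X Z) - conn (br X Y) Z.

Definition ricci_tensor (R : realType) (V : vectType R)
    (br conn : V -> V -> V) (g : V -> V -> R) (e1 e2 e3 : V) (X Y : V) : R :=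
  - g (curvature br conn X e1 Y) e1
  - g (curvature br conn X e2 Y) e2
  + g (curvature br conn X e3 Y) e3.

(* The Ricci tensor need not be symmetric: Ric acts on its first argument. *)
Definition ricci_operator (R : realType) (V : vectType R)
    (br conn : V -> V -> V) (g : V -> V -> R) (e1 e2 e3 : V)
    (Ric : 'End(V)) : Prop :=
  forall X Y, ricci_tensor br conn g e1 e2 e3 X Y = g (Ric X) Y.

Definition derivation (R : realType) (V : vectType R)
    (br : V -> V -> V) (D : 'End(V)) : Prop :=
  forall X Y, D (br X Y) = br (D X) Y + br X (D Y).

Definition soliton_decomposition (R : realType) (V : vectType R)
    (br : V -> V -> V) (Ric : 'End(V)) (c : R) (D : 'End(V)) : Prop :=
  derivation br D /\ Ric = c *: \1%VF + D.

Definition first_kind_soliton (R : realType) (V : vectType R)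
    (br : V -> V -> V) (Ric : 'End(V)) (c : R) : Prop :=
  exists D : 'End(V), soliton_decomposition br Ric c D.

(* Main.v *)
(* The Koszul formula determines nabla on the basis, hence nabla^1 and Ric^1:
   Ric^1 has rows (-(a^2+b^2), ab, ab), (ab, -(a^2+b^2), -a^2), (0, 0, 0).
   For D = Ric^1 - c Id, the e2-component of D[e1,e2] = [De1,e2] + [e1,De2]
   reads a^2 b = 0 and, once b = 0, its e1-component reads a c = 0.  For
   b = c = 0 the identity holds on all pairs of vectors. *)
Require Import Defs.
From mathcomp Require Import all_boot all_order all_algebra sesquilinear reals.
From mathcomp Require Import ring lra.
Import GRing.Theory.
Local Open Scope ring_scope.

(** Normal form for vectors: once both sides of a vector identity are brought to this shape,
    [congr comb3] leaves three polynomial identities over [R]. *)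
Definition comb3 {R : realType} {V : vectType R} (e1 e2 e3 : V) (x y z : R) : V :=
  x *: e1 + y *: e2 + z *: e3.

Lemma comb3D (R : realType) (V : vectType R) (e1 e2 e3 : V) (x y z x' y' z' : R) :
  comb3 e1 e2 e3 x y z + comb3 e1 e2 e3 x' y' z' =
  comb3 e1 e2 e3 (x + x') (y + y') (z + z').
Proof.
by rewrite /comb3 !scalerDl addrACA; congr (_ + _); rewrite addrACA.
Qed.

Lemma comb3Z (R : realType) (V : vectType R) (e1 e2 e3 : V) (k x y z : R) :
  k *: comb3 e1 e2 e3 x y z = comb3 e1 e2 e3 (k * x) (k * y) (k * z).
Proof. by rewrite /comb3 !scalerDr !scalerA. Qed.

Lemma comb3N (R : realType) (V : vectType R) (e1 e2 e3 : V) (x y z : R) :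
  - comb3 e1 e2 e3 x y z = comb3 e1 e2 e3 (- x) (- y) (- z).
Proof. by rewrite -scaleN1r comb3Z !mulN1r. Qed.

Lemma comb3_linear (R : realType) (V : vectType R) (e1 e2 e3 : V)
    (f : 'End(V)) (x y z : R) :
  f (comb3 e1 e2 e3 x y z) = comb3 (f e1) (f e2) (f e3) x y z.
Proof. by rewrite /comb3 !linearD !linearZ. Qed.

Lemma comb3_bilinear (R : realType) (V : vectType R) (e1 e2 e3 : V)
    (B : {bilinear V -> V -> V}) (x1 x2 x3 y1 y2 y3 : R) :
  B (comb3 e1 e2 e3 x1 x2 x3) (comb3 e1 e2 e3 y1 y2 y3) =
  x1 *: (y1 *: B e1 e1 + y2 *: B e1 e2 + y3 *: B e1 e3) +
  x2 *: (y1 *: B e2 e1 + y2 *: B e2 e2 + y3 *: B e2 e3) +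
  x3 *: (y1 *: B e3 e1 + y2 *: B e3 e2 + y3 *: B e3 e3).
Proof.
by rewrite /comb3 !linearDl !linearZl_LR /= !linearDr !linearZr_LR.
Qed.

Lemma comb3_basis {R : realType} {V : vectType R} (e1 e2 e3 : V) :
  [/\ e1 = comb3 e1 e2 e3 1 0 0, e2 = comb3 e1 e2 e3 0 1 0
    & e3 = comb3 e1 e2 e3 0 0 1].
Proof. by split; rewrite /comb3 !scale0r scale1r ?addr0 ?add0r. Qed.

Lemma comb3_surj {R : realType} {V : vectType R} {e1 e2 e3 : V} (v : V) :
  basis_of fullv [:: e1; e2; e3] -> exists x y z, v = comb3 e1 e2 e3 x y z.
Proof.
move=> eB; have /coord_span-> : v \in <<in_tuple [:: e1; e2; e3]>>%VS.
  by rewrite (span_basis eB) memvf.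
by rewrite !big_ord_recl big_ord0 /= addr0 addrA; do 3!eexists.
Qed.

Lemma metric_comb3 {R : realType} {V : vectType R} {g : {biscalar V}}
    {e1 e2 e3 : V} (x1 x2 x3 y1 y2 y3 : R) :
  pseudo_orthonormal_basis g e1 e2 e3 ->
  g (comb3 e1 e2 e3 x1 x2 x3) (comb3 e1 e2 e3 y1 y2 y3) =
  x1 * y1 + x2 * y2 - x3 * y3.
Proof.
case=> _ [g11 g22 g33] [g12 g13 g23] [g21 g31 g32].
rewrite /comb3 !linearDl !linearZl_LR /= !linearDr !linearZr_LR /=.
by rewrite g11 g22 g33 g12 g13 g23 g21 g31 g32; ring.
Qed.

(** The type [{biscalar V}] carries no symmetry; it comes from the Gram matrix diag(1, 1, -1). *)
Lemma metric_sym {R : realType} {V : vectType R} {g : {biscalar V}}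
    {e1 e2 e3 : V} (X Y : V) :
  pseudo_orthonormal_basis g e1 e2 e3 -> g X Y = g Y X.
Proof.
move=> eP; have [eB _ _ _] := eP.
have [x1 [x2 [x3 ->]]] := comb3_surj X eB.
have [y1 [y2 [y3 ->]]] := comb3_surj Y eB.
by rewrite !(metric_comb3 _ _ _ _ _ _ eP); ring.
Qed.

Lemma metric_coord {R : realType} {V : vectType R} {g : {biscalar V}}
    {e1 e2 e3 : V} (x y z : R) :
  pseudo_orthonormal_basis g e1 e2 e3 ->
  [/\ g (comb3 e1 e2 e3 x y z) e1 = x, g (comb3 e1 e2 e3 x y z) e2 = y
    & g (comb3 e1 e2 e3 x y z) e3 = - z].
Proof.
case=> _ [g11 g22 g33] [g12 g13 g23] [g21 g31 g32].
rewrite /comb3 !linearDl !linearZl_LR /=.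
by rewrite g11 g22 g33 g12 g13 g23 g21 g31 g32; split; ring.
Qed.

(** Pairing with the basis recovers coordinates; the last one changes sign because [e3] is
    timelike. *)
Lemma comb3_metric {R : realType} {V : vectType R} {g : {biscalar V}}
    {e1 e2 e3 : V} (v : V) :
  pseudo_orthonormal_basis g e1 e2 e3 ->
  v = comb3 e1 e2 e3 (g v e1) (g v e2) (- g v e3).
Proof.
move=> eP; have [eB _ _ _] := eP.
have [x [y [z ->]]] := comb3_surj v eB.
by have [-> -> ->] := metric_coord x y z eP; rewrite opprK.
Qed.

Lemma comb3_inj {R : realType} {V : vectType R} {g : {biscalar V}}
    {e1 e2 e3 : V} {x y z x' y' z' : R} :
  pseudo_orthonormal_basis g e1 e2 e3 ->
  comb3 e1 e2 e3 x y z = comb3 e1 e2 e3 x' y' z' ->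
  [/\ x = x', y = y' & z = z'].
Proof.
move=> eP Exyz; have [Ex Ey Ez] := metric_coord x y z eP.
have [Ex' Ey' Ez'] := metric_coord x' y' z' eP; rewrite Exyz in Ex Ey Ez.
by split; [rewrite -Ex|rewrite -Ey|apply: oppr_inj; rewrite -Ez].
Qed.

Lemma koszul {R : realType} {V : vectType R} {br : {bilinear V -> V -> V}}
    {g : {biscalar V}} {nabla : {bilinear V -> V -> V}} (X Y Z : V) :
  (forall X Y, g X Y = g Y X) -> levi_civita br g nabla ->
  g (nabla X Y) Z = 2%:R^-1 * (g (br X Y) Z - g (br Y Z) X + g (br Z X) Y).
Proof.
move=> gC [torsion_free metric].
have := metric X Y Z; have := metric Y Z X; have := metric Z X Y.
(* Symmetry moves the covariant derivative into the first slot of [g]. The claim is then a linear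
   combination of the three cyclic instances of metric compatibility. *)
rewrite -!torsion_free !linearBl /= (gC X) (gC Y) (gC Z) => *; nra.
Qed.

Definition g1_brackets {R : realType} {V : vectType R}
    (br : V -> V -> V) (e1 e2 e3 : V) (a b : R) : Prop :=
  [/\ forall X, br X X = 0,
      br e1 e2 = a *: e1 - b *: e3,
      br e1 e3 = - a *: e1 - b *: e2 &
      br e2 e3 = b *: e1 + a *: e2 + a *: e3].

Lemma g1_bracket {R : realType} {V : vectType R}
    {br : {bilinear V -> V -> V}} {e1 e2 e3 : V} {a b : R}
    (x1 x2 x3 y1 y2 y3 : R) :
  g1_brackets br e1 e2 e3 a b ->
  br (comb3 e1 e2 e3 x1 x2 x3) (comb3 e1 e2 e3 y1 y2 y3) =
  comb3 e1 e2 e3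
    (a * (x1 * y2 - x2 * y1) - a * (x1 * y3 - x3 * y1)
       + b * (x2 * y3 - x3 * y2))
    (- b * (x1 * y3 - x3 * y1) + a * (x2 * y3 - x3 * y2))
    (- b * (x1 * y2 - x2 * y1) + a * (x2 * y3 - x3 * y2)).
Proof.
case=> br0 br12 br13 br23.
(* Antisymmetry by polarization: expand [br (X + Y) (X + Y) = 0]. *)
have brC X Y : br X Y = - br Y X.
  apply/eqP; rewrite -addr_eq0; apply/eqP.
  by have := br0 (X + Y); rewrite linearDl /= !linearDr /= !br0 add0r addr0.
have zeroE : 0 = comb3 e1 e2 e3 (0 : R) 0 0 by rewrite /comb3 !scale0r !addr0.
have E12 : br e1 e2 = comb3 e1 e2 e3 a 0 (- b).
  by rewrite br12 /comb3 scale0r addr0 scaleNr.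
have E13 : br e1 e3 = comb3 e1 e2 e3 (- a) (- b) 0.
  by rewrite br13 /comb3 scale0r addr0 !scaleNr.
have E23 : br e2 e3 = comb3 e1 e2 e3 b a a by rewrite br23.
rewrite comb3_bilinear !br0 (brC e2 e1) (brC e3 e1) (brC e3 e2) E12 E13 E23.
by rewrite zeroE !(comb3N, comb3Z, comb3D); congr comb3; ring.
Qed.

Lemma g1_levi_civita {R : realType} {V : vectType R}
    {br nabla : {bilinear V -> V -> V}} {g : {biscalar V}}
    {e1 e2 e3 : V} {a b : R} (x1 x2 x3 y1 y2 y3 : R) :
  pseudo_orthonormal_basis g e1 e2 e3 -> g1_brackets br e1 e2 e3 a b ->
  levi_civita br g nabla ->
  nabla (comb3 e1 e2 e3 x1 x2 x3) (comb3 e1 e2 e3 y1 y2 y3) =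
  comb3 e1 e2 e3
    (a * x1 * (y2 - y3) + b / 2%:R * (x2 * y3 - x3 * y2))
    (- a * x1 * y1 + a * (x2 - x3) * y3 + b / 2%:R * (x3 * y1 - x1 * y3))
    (- a * x1 * y1 + a * (x2 - x3) * y2 + b / 2%:R * (x2 * y1 - x1 * y2)).
Proof.
move=> eP brP LC; have [E1 E2 E3] := comb3_basis e1 e2 e3.
pose v z1 z2 z3 := comb3 e1 e2 e3 z1 z2 z3.
(* With an arbitrary third vector in coordinates, every term of the Koszul formula can be evaluated;
   its three basis specializations then give the coordinates of [nabla]. *)
have K z1 z2 z3 : g (nabla (v x1 x2 x3) (v y1 y2 y3)) (v z1 z2 z3) =
    (a * x1 * (y2 - y3) + b / 2%:R * (x2 * y3 - x3 * y2)) * z1 +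
    (- a * x1 * y1 + a * (x2 - x3) * y3 + b / 2%:R * (x3 * y1 - x1 * y3)) * z2 -
    (- a * x1 * y1 + a * (x2 - x3) * y2 + b / 2%:R * (x2 * y1 - x1 * y2)) * z3.
  rewrite (koszul _ _ _ (fun X Y => metric_sym X Y eP) LC).
  by rewrite !(g1_bracket _ _ _ _ _ _ brP) !(metric_comb3 _ _ _ _ _ _ eP); field.
rewrite [LHS](comb3_metric _ eP).
have := K 1 0 0; have := K 0 1 0; have := K 0 0 1.
rewrite /v -E1 -E2 -E3 => -> -> ->.
by congr comb3; ring.
Qed.

(** This connection preserves the eigenspaces <e1, e2> and <e3> of [J]. For X and Y in the same
    eigenspace it is the projection of [nabla X Y] to it; for X and Y in different ones it is the
    projection of [br X Y] to the eigenspace of Y. *)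
Lemma g1_kobayashi_nomizu {R : realType} {V : vectType R}
    {br nabla : {bilinear V -> V -> V}} {g : {biscalar V}}
    {e1 e2 e3 : V} {J : 'End(V)} {a b : R} (x1 x2 x3 y1 y2 y3 : R) :
  pseudo_orthonormal_basis g e1 e2 e3 -> g1_brackets br e1 e2 e3 a b ->
  levi_civita br g nabla -> product_structure e1 e2 e3 J ->
  kobayashi_nomizu nabla J (comb3 e1 e2 e3 x1 x2 x3) (comb3 e1 e2 e3 y1 y2 y3) =
  comb3 e1 e2 e3 (a * (x1 * y2 + x3 * y1) - b * x3 * y2)
    (- a * (x1 * y1 + x3 * y2) + b * x3 * y1) (a * x2 * y3).
Proof.
move=> eP brP LC [J1 J2 J3].
have JE x y z : J (comb3 e1 e2 e3 x y z) = comb3 e1 e2 e3 x y (- z).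
  by rewrite comb3_linear J1 J2 J3 /comb3 scalerN scaleNr.
rewrite /kobayashi_nomizu /canonical_connection /nablaJ.
rewrite !(JE, g1_levi_civita _ _ _ _ _ _ eP brP LC, comb3N, comb3Z, comb3D).
by congr comb3; field.
Qed.

(** The right-hand side is arranged as g (Ric X) Y: the minus sign before the [y3] term is that of
    the timelike direction, and [x3] is absent because Ric kills [e3]. *)
Lemma g1_ricci_tensor {R : realType} {V : vectType R}
    {br nabla : {bilinear V -> V -> V}} {g : {biscalar V}}
    {e1 e2 e3 : V} {J : 'End(V)} {a b : R} (x1 x2 x3 y1 y2 y3 : R) :
  pseudo_orthonormal_basis g e1 e2 e3 -> g1_brackets br e1 e2 e3 a b ->
  levi_civita br g nabla -> product_structure e1 e2 e3 J ->
  ricci_tensor br (kobayashi_nomizu nabla J) g e1 e2 e3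
    (comb3 e1 e2 e3 x1 x2 x3) (comb3 e1 e2 e3 y1 y2 y3) =
  (- (a ^+ 2 + b ^+ 2) * x1 + a * b * x2) * y1 +
  (a * b * x1 - (a ^+ 2 + b ^+ 2) * x2) * y2 -
  (a * b * x1 - a ^+ 2 * x2) * y3.
Proof.
move=> eP brP LC JP; have [E1 E2 E3] := comb3_basis e1 e2 e3.
(* The frame of the trace is generalized to [f1], [f2], [f3] so that it can be put in coordinates
   without rewriting the basis vectors inside [comb3] itself. *)
suff K f1 f2 f3 : f1 = comb3 e1 e2 e3 1 0 0 -> f2 = comb3 e1 e2 e3 0 1 0 ->
    f3 = comb3 e1 e2 e3 0 0 1 ->
    ricci_tensor br (kobayashi_nomizu nabla J) g f1 f2 f3
      (comb3 e1 e2 e3 x1 x2 x3) (comb3 e1 e2 e3 y1 y2 y3) =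
    (- (a ^+ 2 + b ^+ 2) * x1 + a * b * x2) * y1 +
    (a * b * x1 - (a ^+ 2 + b ^+ 2) * x2) * y2 -
    (a * b * x1 - a ^+ 2 * x2) * y3 by exact: K E1 E2 E3.
move=> -> -> ->; rewrite /ricci_tensor /curvature.
rewrite !(g1_bracket _ _ _ _ _ _ brP).
rewrite !(g1_kobayashi_nomizu _ _ _ _ _ _ eP brP LC JP) !(comb3N, comb3D).
by rewrite !(metric_comb3 _ _ _ _ _ _ eP); ring.
Qed.

Lemma g1_ricci_operator {R : realType} {V : vectType R}
    {br nabla : {bilinear V -> V -> V}} {g : {biscalar V}}
    {e1 e2 e3 : V} {J Ric1 : 'End(V)} {a b : R} (x y z : R) :
  pseudo_orthonormal_basis g e1 e2 e3 -> g1_brackets br e1 e2 e3 a b ->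
  levi_civita br g nabla -> product_structure e1 e2 e3 J ->
  ricci_operator br (kobayashi_nomizu nabla J) g e1 e2 e3 Ric1 ->
  Ric1 (comb3 e1 e2 e3 x y z) =
  comb3 e1 e2 e3 (- (a ^+ 2 + b ^+ 2) * x + a * b * y)
    (a * b * x - (a ^+ 2 + b ^+ 2) * y) (a * b * x - a ^+ 2 * y).
Proof.
move=> eP brP LC JP RicP; have [E1 E2 E3] := comb3_basis e1 e2 e3.
rewrite [LHS](comb3_metric _ eP) -!RicP.
have R0 := g1_ricci_tensor x y z _ _ _ eP brP LC JP.
have := R0 1 0 0; have := R0 0 1 0; have := R0 0 0 1.
by rewrite -E1 -E2 -E3 => -> -> ->; congr comb3; ring.
Qed.

(** The hypothesis on [D] is the coordinate form of Ric^1 - c Id, so the equivalence serves both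
    directions of the soliton criterion. *)
Lemma g1_derivationP {R : realType} {V : vectType R}
    {br : {bilinear V -> V -> V}} {g : {biscalar V}} {e1 e2 e3 : V}
    {D : 'End(V)} {a b c : R} :
  a <> 0 -> pseudo_orthonormal_basis g e1 e2 e3 ->
  g1_brackets br e1 e2 e3 a b ->
  (forall x y z, D (comb3 e1 e2 e3 x y z) =
     comb3 e1 e2 e3 (- (a ^+ 2 + b ^+ 2 + c) * x + a * b * y)
       (a * b * x - (a ^+ 2 + b ^+ 2 + c) * y)
       (a * b * x - a ^+ 2 * y - c * z)) ->
  derivation br D <-> b = 0 /\ c = 0.
Proof.
move=> /eqP a0 eP brP DE; have [eB _ _ _] := eP; split=> [Dder|[b0 c0] X Y].
  have := Dder (comb3 e1 e2 e3 1 0 0) (comb3 e1 e2 e3 0 1 0).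
  rewrite !(DE, g1_bracket _ _ _ _ _ _ brP, comb3D) => /(comb3_inj eP)[].
  move=> Ex Ey _.
  have b0 : b = 0.
    apply: (mulfI (expf_neq0 2 a0)); lra.
  by split=> //; apply: (mulfI a0); rewrite b0 in Ex; lra.
(* For b = c = 0 the span of [e1] and e2 + e3 is an abelian ideal; [D] is the scalar -a^2 on it and
   sends [e2] into it, which makes [D] a derivation. *)
have [x1 [x2 [x3 ->]]] := comb3_surj X eB.
have [y1 [y2 [y3 ->]]] := comb3_surj Y eB.
rewrite !(DE, g1_bracket _ _ _ _ _ _ brP, comb3D) b0 c0.
by congr comb3; ring.
Qed.

Theorem theorem2p10 (R : realType) (alpha beta : R) (alpha_neq0 : alpha <> 0)
    (V : vectType R) (br : {bilinear V -> V -> V}) (g : {biscalar V})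
    (e1 e2 e3 : V) (J : 'End(V))
    (br_lie : lie_bracket br)
    (e_basis : pseudo_orthonormal_basis g e1 e2 e3)
    (br12 : br e1 e2 = alpha *: e1 - beta *: e3)
    (br13 : br e1 e3 = - alpha *: e1 - beta *: e2)
    (br23 : br e2 e3 = beta *: e1 + alpha *: e2 + alpha *: e3)
    (J_product : product_structure e1 e2 e3 J)
    (nabla : {bilinear V -> V -> V}) (nabla_LC : levi_civita br g nabla)
    (Ric1 : 'End(V))
    (Ric1_def : ricci_operator br (kobayashi_nomizu nabla J) g e1 e2 e3 Ric1)
    (c : R) :
  (first_kind_soliton br Ric1 c <-> [/\ beta = 0, c = 0 & alpha <> 0]) /\
  (forall D : 'End(V), soliton_decomposition br Ric1 c D ->
     [/\ Ric1 e1 = D e1 /\ D e1 = - alpha ^+ 2 *: e1,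
         Ric1 e2 = D e2 /\ D e2 = - alpha ^+ 2 *: e2 - alpha ^+ 2 *: e3 &
         Ric1 e3 = D e3 /\ D e3 = 0]).
Proof.
have brP : g1_brackets br e1 e2 e3 alpha beta by split=> //; case: br_lie.
have RicE x y z :=
  g1_ricci_operator x y z e_basis brP nabla_LC J_product Ric1_def.
(* The decomposition forces D = Ric^1 - c Id, so being a soliton is a condition on this single
   endomorphism. *)
have solP D : Ric1 = c *: \1%VF + D ->
    derivation br D <-> beta = 0 /\ c = 0.
  move=> RicD; apply: (g1_derivationP alpha_neq0 e_basis brP) => x y z.
  have -> : D = Ric1 - c *: \1%VF by rewrite RicD addrAC subrr add0r.
  rewrite add_lfunE opp_lfunE scale_lfunE id_lfunE RicE comb3Z comb3N comb3D.
  by congr comb3; ring.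
split=> [|D [Dder RicD]].
  split=> [[D [Dder RicD]]|[b0 c0 _]].
    by have [] := (solP D RicD).1 Dder.
  exists (Ric1 - c *: \1%VF).
  have RicD : Ric1 = c *: \1%VF + (Ric1 - c *: \1%VF) by rewrite addrC subrK.
  by split=> //; apply/(solP _ RicD).
have [b0 c0] := (solP D RicD).1 Dder.
(* Since c = 0, [D] and [Ric1] coincide, and both lists of values are the columns of the Ricci
   matrix at beta = 0. *)
have DRic : D = Ric1 by rewrite RicD c0 scale0r add0r.
have [E1 E2 E3] := comb3_basis e1 e2 e3.
have := RicE 1 0 0; have := RicE 0 1 0; have := RicE 0 0 1.
rewrite -E1 -E2 -E3 DRic b0 => -> -> ->.
rewrite /comb3 expr0n /= !(mulr0, mulr1, mul0r, addr0, add0r, subr0, sub0r).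
by rewrite !(oppr0, scale0r, addr0, add0r, scaleNr).
Qed.
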